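(* Let $q\in\mathbb{C}\setminus\{0\}$ and let $A$ be the quantum plane with its bimodule of 1-forms $A^1$ and bimodule automorphism $\tau$ of $A^1\otimes A^1$ as described in the context. If $q$ is not a root of unity, then there is no non-zero middle-linear $\tau$-symmetric metric on $A^1$.
   Context: Unadorned $\otimes$ is the tensor product over $\mathbb{C}$. $A$ is the unital complex algebra generated by $x,y$ with the relation $xy=qyx$. $A^1$ is the $A$-bimodule generated by $\xi=dx$ and $\eta=dy$ subject to $$x\xi=q^2\xi x,\quad x\eta=q\eta x+(q^2-1)\xi y,\quad y\xi=q\xi y,\quad y\eta=q^2\eta y;$$ it is free with basis $\{\xi,\eta\}$ both as a left and as a right $A$-module. $\tau:A^1\otimes A^1\to A^1\otimes A^1$ is the bimodule automorphism (with respect to $a(\zeta\otimes\rho)b=a\zeta\otimes\rho b$) determined by $$\tau(\xi\otimes\xi)=\xi\otimes\xi,\quad \tau(\xi\otimes\eta)=q\,\eta\otimes\xi,\quad \tau(\eta\otimes\xi)=q\,\xi\otimes\eta-(q^2-1)\,\eta\otimes\xi,\quad \tau(\eta\otimes\eta)=\eta\otimes\eta.$$ A $\tau$-symmetric metric on $A^1$ is a linear map $g:A^1\otimes A^1\to A$ (no nondegeneracy is required) such that $g(a\zeta,\rho b)=a\,g(\zeta,\rho)\,b$ for all $\zeta,\rho\in A^1$, $a,b\in A$, and $g\circ\tau=g$. It is middle-linear if it factors through $A^1\otimes_AA^1$, i.e. $g(\zeta a,\rho)=g(\zeta,a\rho)$ for all $a\in A$, $\zeta,\rho\in A^1$. 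*)

(* Defs.v *)
From mathcomp Require Export all_boot all_order all_algebra.
From mathcomp Require Export reals complex.

Set Implicit Arguments.
Unset Strict Implicit.
Unset Printing Implicit Defensive.

Import Order.TTheory GRing.Theory Num.Theory.
Local Open Scope ring_scope.

(* Bilinearity of the two actions over [K] makes [K] act centrally:
   [lact (k *: 1) m = k *: m = ract m (k *: 1)]. *)
Record bimodule (K : fieldType) (A : algType K) := Bimodule {
  bimod_sort :> lmodType K;
  lact : {bilinear A -> bimod_sort -> bimod_sort};
  ract : {bilinear bimod_sort -> A -> bimod_sort};
  lact1 : forall m, lact 1 m = m;
  lactM : forall a b m, lact (a * b) m = lact a (lact b m);
  ract1 : forall m, ract m 1 = m;
  ractM : forall a b m, ract m (a * b) = ract (ract m a) b;
  lact_ract : forall a b m, lact a (ract m b) = ract (lact a m) b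
}.

Arguments lact {K A b} : rename.
Arguments ract {K A b} : rename.

Definition bimod_morphism (K : fieldType) (A : algType K) (M N : bimodule A)
    (f : {linear M -> N}) : Prop :=
  (forall a m, f (lact a m) = lact a (f m)) /\
  (forall a m, f (ract m a) = ract (f m) a).

(* Presentations by generators and relations are expressed through their
   universal properties, which fix the object up to unique isomorphism. *)

Definition quantum_plane (K : fieldType) (q : K) (A : algType K) (x y : A)
    : Prop :=
  [/\ x * y = q *: (y * x),
      forall (B : algType K) (u v : B), u * v = q *: (v * u) ->
        exists f : {lrmorphism A -> B}, f x = u /\ f y = v
    & forall (B : algType K) (f f' : {lrmorphism A -> B}),
        f x = f' x -> f y = f' y -> f =1 f'].

Definition form_relations (K : fieldType) (q : K) (A : algType K) (x y : A)
    (M : bimodule A) (xi eta : M) : Prop :=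
  [/\ lact x xi = q ^+ 2 *: ract xi x,
      lact x eta = q *: ract eta x + (q ^+ 2 - 1) *: ract xi y,
      lact y xi = q *: ract xi y
    & lact y eta = q ^+ 2 *: ract eta y].

Definition quantum_forms (K : fieldType) (q : K) (A : algType K) (x y : A)
    (A1 : bimodule A) (xi eta : A1) : Prop :=
  [/\ form_relations q x y xi eta,
      forall (N : bimodule A) (u v : N), form_relations q x y u v ->
        exists f : {linear A1 -> N}, [/\ bimod_morphism f, f xi = u & f eta = v]
    & forall (N : bimodule A) (f f' : {linear A1 -> N}),
        bimod_morphism f -> bimod_morphism f' ->
        f xi = f' xi -> f eta = f' eta -> f =1 f'].

(* [T] is the tensor product of [M] and [N] over the base field [K] (not over
   [A]), with the outer bimodule structure a (m (x) n) b = (a m) (x) (n b). *)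
Definition tensor_product (K : fieldType) (A : algType K) (M N T : bimodule A)
    (tens : {bilinear M -> N -> T}) : Prop :=
  [/\ forall (W : lmodType K) (f : {bilinear M -> N -> W}),
        exists h : {linear T -> W}, forall m n, h (tens m n) = f m n,
      forall (W : lmodType K) (h h' : {linear T -> W}),
        (forall m n, h (tens m n) = h' (tens m n)) -> h =1 h',
      forall a m n, lact a (tens m n) = tens (lact a m) n
    & forall a m n, ract (tens m n) a = tens m (ract n a)].

Definition braiding (K : fieldType) (q : K) (A : algType K)
    (A1 T : bimodule A) (xi eta : A1) (tens : {bilinear A1 -> A1 -> T})
    (tau : {linear T -> T}) : Prop :=
  [/\ bimod_morphism tau /\ bijective tau,
      tau (tens xi xi) = tens xi xi,
      tau (tens xi eta) = q *: tens eta xi,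
      tau (tens eta xi) = q *: tens xi eta - (q ^+ 2 - 1) *: tens eta xi
    & tau (tens eta eta) = tens eta eta].

Definition symmetric_metric (K : fieldType) (A : algType K)
    (A1 T : bimodule A) (tens : {bilinear A1 -> A1 -> T})
    (tau : {linear T -> T}) (g : {linear T -> A}) : Prop :=
  (forall a b (z r : A1),
     g (tens (lact a z) (ract r b)) = a * g (tens z r) * b) /\
  g \o tau =1 g.

Definition middle_linear (K : fieldType) (A : algType K)
    (A1 T : bimodule A) (tens : {bilinear A1 -> A1 -> T})
    (g : {linear T -> A}) : Prop :=
  forall a (z r : A1), g (tens (ract z a) r) = g (tens z (lact a r)).

(* Main.v *)
From HB Require Import structures.
Require Import Defs.
From mathcomp Require Import boolp ring.

Import Order.TTheory GRing.Theory Num.Theory.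
Local Open Scope ring_scope.

(* For generators u, v among xi, eta, moving y through a middle-linear metric g
   gives y g(u, v) = q ^ k g(u, v) y with 2 <= k <= 4. Writing an element a of A
   as the sum of the p_i(y) x ^ i, the equation y a = q ^ k a y forces
   (1 - q ^ (i + k)) p_i = 0; this is read off matrix representations in which x
   is a shift and y is diagonal, and it gives a = 0 when k > 0 and q is not a
   root of unity. So g vanishes on generators, hence everywhere because
   A^1 = xi A + eta A. *)

(** * Induction principles from the universal properties *)

Definition subalg_sort {K : fieldType} {A : algType K}
    (S : subalgClosed A) :=
  {a : A | a \in S}.

Section SubalgSort.
Context {K : fieldType} {A : algType K} (S : subalgClosed A).
HB.instance Definition _ := SubChoice.on (subalg_sort S).
HB.instance Definition _ := [SubChoice_isSubAlgebra of subalg_sort S by <:].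
(* The morphism instances of [val] are not joined into an [LRMorphism]. *)
Definition subalg_incl : subalg_sort S -> A := val.
HB.instance Definition _ := GRing.RMorphism.copy subalg_incl
  (val : subalg_sort S -> A).
HB.instance Definition _ := GRing.Linear.copy subalg_incl
  (val : subalg_sort S -> A).
End SubalgSort.

Definition submod_sort {K : fieldType} {M : lmodType K}
    (S : submodClosed M) :=
  {m : M | m \in S}.

Section SubmodSort.
Context {K : fieldType} {M : lmodType K} (S : submodClosed M).
HB.instance Definition _ := SubChoice.on (submod_sort S).
HB.instance Definition _ := [SubChoice_isSubLmodule of submod_sort S by <:].
End SubmodSort.

(** The universal property gives [f] from [A] to [S] fixing [x] and [y]; followed by the inclusion
    it agrees with the identity on [x] and [y], hence everywhere. *)
Lemma subalg_full {K : fieldType} {q : K} {A : algType K} {x y : A}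
    (S : subalgClosed A) :
  quantum_plane q x y -> x \in S -> y \in S -> forall a, a \in S.
Proof.
move=> [xy ex_f uniq_f] Sx Sy.
pose x' : subalg_sort S := Sub x Sx; pose y' : subalg_sort S := Sub y Sy.
have xy' : x' * y' = q *: (y' * x').
  by apply: val_inj; rewrite rmorphM linearZ rmorphM.
have [f [fx fy]] := ex_f _ _ _ xy'.
move=> a; have := uniq_f _ (subalg_incl S \o f : {lrmorphism A -> A}) idfun _ _ a.
by rewrite /= fx fy => <- //; apply: valP.
Qed.

Lemma quantum_plane_ind {K : fieldType} {q : K} {A : algType K} {x y : A}
    {P : A -> Prop} :
  quantum_plane q x y ->
  P 1 -> (forall c a b, P a -> P b -> P (c *: a + b)) ->
  (forall a b, P a -> P b -> P (a * b)) -> P x -> P y -> forall a, P a.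
Proof.
move=> qp P1 PD PM Px Py.
pose S : {pred A} := fun a => `[< P a >].
have S_alg : subalg_closed S.
  split; first exact/asboolP.
    by move=> c a b /asboolP Pa /asboolP Pb; apply/asboolP/PD.
  by move=> a b /asboolP Pa /asboolP Pb; apply/asboolP/PM.
pose S' : subalgClosed A :=
  HB.pack S (GRing.isSubalgClosed.Build _ _ S S_alg).
by move=> a; apply/asboolP/(subalg_full S' qp); apply/asboolP.
Qed.

(** The argument of [subalg_full] again, once both actions are restricted to [S] to make it a
    bimodule. *)
Lemma submod_full {K : fieldType} {q : K} {A : algType K} {x y : A}
    {A1 : bimodule A} {xi eta : A1} (S : submodClosed A1) :
  quantum_forms q x y xi eta ->
  (forall a u, u \in S -> lact a u \in S) ->
  (forall a u, u \in S -> ract u a \in S) ->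
  xi \in S -> eta \in S -> forall u, u \in S.
Proof.
move=> [rel ex_f uniq_f] Sl Sr Sxi Seta.
pose N := submod_sort S.
pose i : {linear N -> A1} := (val : N -> A1).
pose l a (u : N) : N := Sub (lact a (i u)) (Sl a _ (valP u)).
pose r (u : N) a : N := Sub (ract (i u) a) (Sr a _ (valP u)).
have il a u : i (l a u) = lact a (i u) by [].
have ir u a : i (r u a) = ract (i u) a by [].
have l_bil : bilinear_for *:%R *:%R l.
  split=> [u c a b|a c u v]; apply: val_inj; rewrite -!/(i _).
    by rewrite il linearPl linearP !il.
  by rewrite il !linearP !il.
have r_bil : bilinear_for *:%R *:%R r.
  split=> [u c a b|a c u v]; apply: val_inj; rewrite -!/(i _).
    by rewrite ir linearP linearPl linearP !ir.
  by rewrite ir !linearP !ir.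
pose lB : {bilinear A -> N -> N} :=
  HB.pack l (bilinear_isBilinear.Build _ _ _ _ _ _ l l_bil).
pose rB : {bilinear N -> A -> N} :=
  HB.pack r (bilinear_isBilinear.Build _ _ _ _ _ _ r r_bil).
have l1 m : lB 1 m = m by apply: val_inj; apply: lact1.
have lM a b m : lB (a * b) m = lB a (lB b m).
  by apply: val_inj; apply: lactM.
have r1 m : rB m 1 = m by apply: val_inj; apply: ract1.
have rM a b m : rB m (a * b) = rB (rB m a) b.
  by apply: val_inj; apply: ractM.
have lr a b m : lB a (rB m b) = rB (lB a m) b.
  by apply: val_inj; apply: lact_ract.
pose N' : bimodule A := Bimodule l1 lM r1 rM lr.
pose u : N' := Sub xi Sxi; pose v : N' := Sub eta Seta.
have rel' : form_relations q x y u v.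
  case: rel => r1' r2' r3' r4'.
  by split; apply: (val_inj : injective i); rewrite ?linearD ?linearZ.
have [f [[fl fr] fu fv]] := ex_f _ _ _ rel'.
move=> m.
have -> : m = i (f m); last exact: valP.
pose h : {linear A1 -> A1} := (i \o f).
apply/esym/(uniq_f _ h idfun) => //; rewrite /h /= ?fu ?fv //.
by split=> a w; rewrite /= ?fl ?fr.
Qed.

Lemma quantum_forms_ind {K : fieldType} {q : K} {A : algType K} {x y : A}
    {A1 : bimodule A} {xi eta : A1} {P : A1 -> Prop} :
  quantum_forms q x y xi eta ->
  (forall c u v, P u -> P v -> P (c *: u + v)) ->
  (forall a u, P u -> P (lact a u)) -> (forall a u, P u -> P (ract u a)) ->
  P xi -> P eta -> forall u, P u.
Proof.
move=> qf PD Pl Pr Pxi Peta.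
pose S : {pred A1} := fun a => `[< P a >].
have P0 : P 0 by have := PD (-1) xi xi Pxi Pxi; rewrite scaleN1r addNr.
have S_mod : submod_closed S.
  split; first exact/asboolP.
  by move=> c a b /asboolP Pa /asboolP Pb; apply/asboolP/PD.
pose S' : submodClosed A1 :=
  HB.pack S (GRing.isSubmodClosed.Build _ _ S S_mod).
move=> u; apply/asboolP/(submod_full S' qf).
- by move=> a v /asboolP Pv; apply/asboolP/Pl.
- by move=> a v /asboolP Pv; apply/asboolP/Pr.
- exact/asboolP.
- exact/asboolP.
Qed.

(** * Normal forms in the quantum plane *)

(** The outer variable stands for [x], the inner one for [y]; Horner evaluation keeps coefficients
    on the left, giving the sum of the p_i(y) x ^ i. *)
Definition normal_form {K : fieldType} {A : algType K} (x y : A)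
    (p : {poly {poly K}}) : A :=
  (map_poly (horner_alg y) p).[x].

Lemma normal_formD {K : fieldType} {A : algType K} (x y : A) p r :
  normal_form x y (p + r) = normal_form x y p + normal_form x y r.
Proof. by rewrite /normal_form rmorphD hornerD. Qed.

Lemma normal_formZ {K : fieldType} {A : algType K} (x y : A) c p :
  normal_form x y (c%:P *: p) = c *: normal_form x y p.
Proof.
by rewrite /normal_form map_polyZ hornerZ /= horner_algC mulr_algl.
Qed.

Lemma normal_formMXaddC {K : fieldType} {A : algType K} (x y : A) p c :
  normal_form x y (p * 'X + c%:P) = normal_form x y p * x + horner_alg y c.
Proof.
by rewrite /normal_form rmorphD rmorphM /= map_polyX map_polyC hornerMXaddC.
Qed.

Lemma normal_form_morph {K : fieldType} {A B : algType K}
    (f : {lrmorphism A -> B}) (x y : A) p :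
  f (normal_form x y p) = normal_form (f x) (f y) p.
Proof.
have fh c : f (horner_alg y c) = horner_alg (f y) c.
  elim/poly_ind: c => [|c a IH]; first by rewrite !rmorph0.
  by rewrite !rmorphD !rmorphM /= !horner_algX !horner_algC IH linearZ rmorph1.
elim/poly_ind: p => [|p c IH].
  by rewrite /normal_form !rmorph0 !horner0 rmorph0.
by rewrite !normal_formMXaddC rmorphD rmorphM /= fh IH.
Qed.

Lemma normal_form_surj {K : fieldType} {q : K} {A : algType K} {x y : A} :
  quantum_plane q x y -> forall a, exists p, a = normal_form x y p.
Proof.
move=> qp; have [xy _ _] := qp.
pose P (a : A) := exists p, a = normal_form x y p.
have P1 : P 1 by exists 1; rewrite /normal_form rmorph1 hornerC.
have PD c a b : P a -> P b -> P (c *: a + b).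
  move=> [p ->] [r ->]; exists (c%:P *: p + r).
  by rewrite normal_formD normal_formZ.
have Px a : P a -> P (a * x).
  move=> [p ->]; exists (p * 'X + 0%:P).
  by rewrite normal_formMXaddC rmorph0 addr0.
have Py a : P a -> P (a * y).
  move=> [p ->]; elim/poly_ind: p => [|p c [r IH]].
    by exists 0; rewrite /normal_form rmorph0 horner0 mul0r.
  (* (p x + c) y = q (p y) x + c y, with [r] representing p y. *)
  exists (q%:P *: r * 'X + (c * 'X)%:P).
  rewrite !normal_formMXaddC normal_formZ mulrDl -mulrA xy -scalerAr mulrA IH.
  by rewrite scalerAl rmorphM /= horner_algX.
(* Unlike [P], this property visibly passes to products, so only the generators need a
   computation. *)
pose Q a := forall b, P b -> P (b * a).
suff PM a : Q a by move=> a; rewrite -(mul1r a); apply: PM.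
apply: (quantum_plane_ind (P := Q) qp) =>
  [b|c {}a a' IH IH' b Pb|{}a a' IH IH' b Pb|//|//].
- by rewrite mulr1.
- by rewrite mulrDr -scalerAr; apply: PD; [apply: IH|apply: IH'].
- by rewrite mulrA; apply/IH'/IH.
Qed.

(** * Matrix representations of the quantum plane *)

(* These truncate the action of the quantum plane on the span of e_0, e_1, ...
   given by x e_j = e_(j+1) and y e_j = (t / q ^ j) e_j. *)
Definition shift_mx (K : fieldType) (n : nat) : 'M[K]_n.+1 :=
  \matrix_(i, j) (i == j.+1 :> nat)%:R.

Definition weight_mx {K : fieldType} (q t : K) (n : nat) : 'M[K]_n.+1 :=
  diag_mx (\row_i (t / q ^+ i)).

(** The e_j with j > n span an invariant subspace, so truncation keeps the relation; at entry (j +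
    1, j) it reads t / q ^ j = q (t / q ^ (j + 1)). *)
Lemma shift_weight_mx {K : fieldType} (q t : K) n : q != 0 ->
  shift_mx K n * weight_mx q t n = q *: (weight_mx q t n * shift_mx K n).
Proof.
move=> q0; rewrite -!mulmxE /weight_mx mul_mx_diag mul_diag_mx.
apply/matrixP => i j; rewrite !mxE.
case: eqP => [->|_]; last by rewrite !(mul0r, mulr0).
by rewrite mul1r mulr1 exprS invfM !mulrA [q * t]mulrC mulfK.
Qed.

(** p_k(y) x ^ k sends e_j to p_k(t / q ^ (j + k)) e_(j + k), so entry (i, j) sees only k = i -
    j. *)
Lemma normal_form_mx {K : fieldType} (q t : K) n p (i j : 'I_n.+1) :
  normal_form (shift_mx K n) (weight_mx q t n) p i j =
  if (j <= i)%N then (p`_(i - j)).[t / q ^+ i] else 0.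
Proof.
elim/poly_ind: p i j => [|p c IH] i j.
  by rewrite /normal_form rmorph0 horner0 !mxE coef0 horner0 if_same.
rewrite normal_formMXaddC -mulmxE mxE.
have -> : horner_alg (weight_mx q t n) c i j = c.[t / q ^+ i] *+ (i == j).
  have -> : horner_alg (weight_mx q t n) c = horner_mx (weight_mx q t n) c.
    rewrite /horner_alg /horner_mx /horner_morph; congr _.[_].
    by apply: eq_map_poly => a; apply: scalemx1.
  by rewrite horner_mx_diag !mxE.
rewrite mxE; case: (ltngtP j i) => [ji|ij|/val_inj ->].
(* The chosen index is j + 1, the only one at which column j of the shift is nonzero. *)
- rewrite (bigD1 (Ordinal (leq_ltn_trans ji (ltn_ord i)))) //= big1 => [|k ki].
    rewrite addr0 IH !mxE /= ji eqxx mulr1 coefD coefMX coefC.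
    rewrite subn_eq0 leqNgt ji /= addr0 eq_sym -val_eqE (ltn_eqF ji) mulr0n addr0.
    by rewrite subnS.
  rewrite !mxE [_ == j.+1 :> nat](_ : _ = false) ?mulr0 //.
  by apply: contraNF ki => /eqP kj; apply/eqP/val_inj.
- rewrite -val_eqE (ltn_eqF ij) mulr0n addr0 big1 // => k _.
  rewrite IH !mxE; case: eqP => [->|_]; last by rewrite mulr0.
  by rewrite leqNgt ltnS (ltnW ij) mul0r.
- rewrite eqxx mulr1n big1 ?add0r => [|k _].
    by rewrite subnn coefD coefMX coefC add0r.
  rewrite IH !mxE; case: eqP => [->|_]; last by rewrite mulr0.
  by rewrite ltnn mul0r.
Qed.

(** The powers of [q] are nonzero and pairwise distinct, so a nonzero [p] would have [size p]
    distinct roots, one more than its degree. *)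
Lemma poly_eq0_nonzero_points {K : fieldType} (q : K) (p : {poly K}) : q != 0 ->
  (forall n : nat, (0 < n)%N -> ~~ n.-unity_root q) ->
  (forall t, t != 0 -> p.[t] = 0) -> p = 0.
Proof.
move=> q0 qn p0; apply/eqP/negPn/negP => pN0.
have q_inj : injective (GRing.exp q).
  have lt m n : (m < n)%N -> q ^+ m != q ^+ n.
    move=> mn; apply/eqP => qmn; have := qn (n - m)%N.
    rewrite subn_gt0 mn => /(_ isT)/negP[]; apply/unity_rootP.
    apply: (mulfI (expf_neq0 m q0)).
    by rewrite -exprD subnKC ?(ltnW mn) // mulr1.
  move=> m n qmn; case: (ltngtP m n) => // /lt; first by rewrite qmn eqxx.
  by rewrite -[q ^+ n]/(GRing.exp q n) -qmn eqxx.
have := max_poly_roots (rs := [seq q ^+ i | i <- iota 0 (size p)]) pN0.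
rewrite map_inj_uniq // iota_uniq size_map size_iota ltnn => H.
suff: false by []; apply: H => //; apply/allP => _ /mapP[i _ ->].
by apply/rootP/p0/expf_neq0.
Qed.

Lemma skew_commute_eq0 {K : fieldType} {q : K} {A : algType K} {x y : A}
    (k : nat) (a : A) :
  q != 0 -> (forall n : nat, (0 < n)%N -> ~~ n.-unity_root q) ->
  quantum_plane q x y -> (0 < k)%N -> y * a = q ^+ k *: (a * y) -> a = 0.
Proof.
move=> q0 qn qp k0; have [p ->] := normal_form_surj qp a.
move=> comm; suff -> : p = 0 by rewrite /normal_form rmorph0 horner0.
apply/polyP => i; rewrite coef0; apply: (poly_eq0_nonzero_points q) => // t t0.
have [_ ex_f _] := qp.
(* With this weight and size, y acts by t on the last vector e_i, so entry (i, 0) of the image of a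
   is p_i(t). *)
have [f [fx fy]] := ex_f _ _ _ (shift_weight_mx q (t * q ^+ i) i q0).
have := congr1 (fun M : 'M[K]_i.+1 => M ord_max ord0) (congr1 f comm).
rewrite linearZ !rmorphM /= normal_form_morph fx fy -!mulmxE.
rewrite /= {1 4}/weight_mx mul_diag_mx mul_mx_diag !mxE normal_form_mx /=.
(* As y has weight t at e_i and t q ^ i at e_0, [tv] amounts to t v = q ^ (i + k) t v. *)
rewrite subn0 mulfK ?expf_neq0 // expr0 divr1; set v := _.[_] => tv.
have := qn (i + k)%N; rewrite addn_gt0 k0 orbT => /(_ isT).
apply: contraNeq => vN0; apply/unity_rootP.
by apply: (mulfI (mulf_neq0 t0 vN0)); rewrite mulr1 [RHS]tv exprD; ring.
Qed.

(** * Spanning the forms and vanishing of the metric *)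

(* The right [A]-span of [xi] and [eta] is stable under the left action of [x]
   and [y], which generate [A], hence is a sub-bimodule. *)
Lemma forms_right_span {K : fieldType} {q : K} {A : algType K} {x y : A}
    {A1 : bimodule A} {xi eta : A1} :
  quantum_plane q x y -> quantum_forms q x y xi eta ->
  forall u, exists a b, u = ract xi a + ract eta b.
Proof.
move=> qp qf; have [[xxi xeta yxi yeta] _ _] := qf.
pose P (u : A1) := exists a b, u = ract xi a + ract eta b.
have PD c u v : P u -> P v -> P (c *: u + v).
  move=> [a [b ->]] [a' [b' ->]]; exists (c *: a + a'), (c *: b + b').
  by rewrite !linearPr scalerDr addrACA.
have Pr a u : P u -> P (ract u a).
  move=> [b [c ->]]; exists (b * a), (c * a).
  by rewrite linearDl !ractM.
pose Q a := forall u, P u -> P (lact a u).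
(* The two actions commute, so stability of the right span need only be tested on [xi] and [eta]. *)
have Q_gen a : P (lact a xi) -> P (lact a eta) -> Q a.
  move=> Pxi Peta _ [b [c ->]].
  rewrite linearDr !lact_ract -[X in P (X + _)]scale1r.
  by apply: PD; apply: Pr.
have Pxi a : P (ract xi a) by exists a, 0; rewrite linear0r addr0.
have Peta a : P (ract eta a) by exists 0, a; rewrite linear0r add0r.
have P0 : P 0 by exists 0, 0; rewrite !linear0r addr0.
have PZ c u : P u -> P (c *: u) by move=> Pu; rewrite -[_ *: _]addr0; apply: PD.
have Pl : forall a, Q a.
  apply: (quantum_plane_ind (P := Q) qp) =>
    [u|c a b Qa Qb u Pu|a b Qa Qb u Pu||].
  - by rewrite lact1.
  - by rewrite linearPl; apply: PD; [apply: Qa|apply: Qb].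
  - by rewrite lactM; apply/Qa/Qb.
  - by apply: Q_gen; rewrite ?xxi ?xeta; [apply: PZ|apply: PD => //; apply: PZ].
  - by apply: Q_gen; rewrite ?yxi ?yeta; apply: PZ.
apply: (quantum_forms_ind (P := P) qf) => //.
- by rewrite -(ract1 xi).
- by rewrite -(ract1 eta).
Qed.

Theorem proposition3p1 (R : realType) (q : R[i])
    (A : algType R[i]) (x y : A)
    (A1 : bimodule A) (xi eta : A1)
    (T : bimodule A) (tens : {bilinear A1 -> A1 -> T})
    (tau : {linear T -> T}) :
  q != 0 ->
  quantum_plane q x y ->
  quantum_forms q x y xi eta ->
  tensor_product tens ->
  braiding q xi eta tens tau ->
  (forall n : nat, (0 < n)%N -> ~~ n.-unity_root q) ->
  ~ exists g : {linear T -> A},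
      [/\ symmetric_metric tens tau g,
          middle_linear tens g
        & exists t : T, g t != 0].
Proof.
move=> q0 qp qf [_ uniq_T _ _] _ qn [g [[g_bimod _] g_mid [t /eqP]]]; case.
have gl a u v : g (tens (lact a u) v) = a * g (tens u v).
  by have := g_bimod a 1 u v; rewrite ract1 mulr1.
have gr u v a : g (tens u (ract v a)) = g (tens u v) * a.
  by have := g_bimod 1 a u v; rewrite lact1 mul1r.
have [[_ _ yxi yeta] _ _] := qf.
(* y g(u, v) = q ^ (m + 1) g(u y, v) = q ^ (m + 1) g(u, y v) = q ^ (m + 1 + n) g(u, v) y. Here y is
   moved because it scales both generators, whereas x mixes [eta] with [xi]. *)
have g_gen m n u v : lact y u = q ^+ m.+1 *: ract u y ->
    lact y v = q ^+ n *: ract v y -> g (tens u v) = 0.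
  move=> yu yv; apply: (skew_commute_eq0 (m.+1 + n) _ q0 qn qp) => //.
  rewrite -gl yu linearZl linearZ /= g_mid yv linearZr linearZ /= gr.
  by rewrite scalerA exprD.
have g_gens u v : u = xi \/ u = eta -> v = xi \/ v = eta -> g (tens u v) = 0.
  have yxi1 : lact y xi = q ^+ 1 *: ract xi y by rewrite expr1.
  by case=> ->; case=> ->; apply: g_gen; eassumption.
have span := forms_right_span qp qf.
have g_left u v : u = xi \/ u = eta -> g (tens u v) = 0.
  move=> uE; have [a [b ->]] := span v.
  by rewrite linearDr linearD /= !gr !g_gens ?mul0r ?addr0 //; [right|left].
(* Right coefficients of [u] cross into the second slot by middle-linearity, which is why [g_left]
   allows arbitrary [v]. *)
have g0 u v : g (tens u v) = 0.
  have [a [b ->]] := span u.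
  rewrite linearDl linearD /= !g_mid !g_left ?addr0 //; [right|left] => //.
exact: (uniq_T _ g \0 g0).
Qed.
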